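(* Let $n\ge 1$, let $V\subset\mathbb{R}^{n+1}$ be a compact convex set and let $\mathscr{M}=\partial V$ be the corresponding $n$-dimensional closed convex surface. If the Minkowski polynomial $M_V^{\mathbb{R}^{n+1}}$ is dissipative, then the Weyl polynomial $W^{1}_{\mathscr{M}}$ of index $1$ is conservative.
   Context: Compact convex sets are nonempty. For a compact convex $V\subset\mathbb{R}^{N}$, with $B^{N}$ the closed Euclidean unit ball of $\mathbb{R}^N$, the function $t\mapsto \mathrm{Vol}_N(V+tB^N)$, $t\ge 0$, is (Minkowski) a polynomial in $t$ of degree $N$; it is called the Minkowski polynomial $M_V^{\mathbb{R}^N}(t)=\sum_{k=0}^{N} m_k^{\mathbb{R}^N}(V)t^k$ and is considered for all complex $t$. For compact convex $V\subset\mathbb{R}^{n+1}$ and $\mathscr{M}=\partial V$, the Weyl polynomial of index $1$ is defined by $2t\,W^1_{\mathscr{M}}(t)=M_V^{\mathbb{R}^{n+1}}(t)-M_V^{\mathbb{R}^{n+1}}(-t)$, i.e. $W^1_{\mathscr{M}}(t)=\sum_{0\le l\le [n/2]} m_{2l+1}^{\mathbb{R}^{n+1}}(V)t^{2l}$. A polynomial is dissipative if all its (complex) roots lie in the open left half-plane $\{z:\mathrm{Re}\,z<0\}$. A polynomial is conservative if all its roots are purely imaginary (lie in $\{z:\mathrm{Re}\,z=0\}$) and simple. *)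

(* Defs.v *)
From HB Require Import structures.
From mathcomp Require Import all_boot all_order all_algebra.
From mathcomp Require Import complex.
From mathcomp Require Import all_classical all_reals all_analysis.
From mathcomp Require Import measurable_realfun.
Import numFieldNormedType.Exports.

Set Implicit Arguments.
Unset Strict Implicit.
Unset Printing Implicit Defensive.

Import Order.TTheory GRing.Theory Num.Theory.
Local Open Scope classical_set_scope.
Local Open Scope ring_scope.

(* N-dimensional Lebesgue measure on R^N, as the N-fold product of
   lebesgue_measure: as in product_measure1, the measure of A is the integral
   over the first coordinate of the measure of its sections; R^0 is a point of
   mass 1.  By Tonelli this is the Lebesgue measure on Borel sets, in particular
   on the compact sets it is used for. *)
Fixpoint volume (R : realType) (N : nat) : set 'rV[R]_N -> \bar R :=
  match N return set 'rV[R]_N -> \bar R with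
  | 0 => fun A => (\1_A (0 : 'rV[R]_0))%:E
  | N'.+1 => fun A =>
      (\int[@lebesgue_measure R]_x
         volume [set y : 'rV[R]_N' | A (row_mx (x%:M : 'rV[R]_1) y)])%E
  end.

(* The library norm on 'rV[R]_N is the sup norm; it has the same topology. *)
Definition euclidean_norm (R : realType) (N : nat) (x : 'rV[R]_N) : R :=
  Num.sqrt (\sum_(i < N) x ord0 i ^+ 2).

Definition euclidean_unit_ball (R : realType) (N : nat) : set 'rV[R]_N :=
  [set x | euclidean_norm x <= 1].

Definition parallel_body (R : realType) (N : nat) (V : set 'rV[R]_N) (t : R) :
    set 'rV[R]_N :=
  [set v + t *: b | v in V & b in @euclidean_unit_ball R N].

Definition is_minkowski_poly (R : realType) (N : nat) (V : set 'rV[R]_N)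
    (p : {poly R}) : Prop :=
  forall t : R, 0 <= t -> volume (parallel_body V t) = (p.[t])%:E.

(* Such a polynomial is unique (minkowski_polyE) and, by Minkowski's theorem,
   exists when V is nonempty, compact and convex; 0 is a default value. *)
Definition minkowski_poly (R : realType) (N : nat) (V : set 'rV[R]_N) :
    {poly R} :=
  xget 0 [set p | is_minkowski_poly V p].

(* W^1 of the boundary of V, from 2 t W^1(t) = M_V(t) - M_V(- t); the division
   is exact (weyl1_polyP). *)
Definition weyl1_poly (R : realType) (N : nat) (V : set 'rV[R]_N) : {poly R} :=
  (minkowski_poly V - (minkowski_poly V \Po (- 'X))) %/ (2 *: 'X).

Definition complex_poly (R : realType) (p : {poly R}) : {poly R[i]} :=
  map_poly (real_complex R) p.

Definition dissipative (R : realType) (p : {poly R[i]}) : Prop :=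
  forall z : R[i], root p z -> complex.Re z < 0.

Definition conservative (R : realType) (p : {poly R[i]}) : Prop :=
  forall z : R[i], root p z -> complex.Re z = 0 /\ mup z p = 1%N.

Lemma minkowski_polyE (R : realType) (N : nat) (V : set 'rV[R]_N)
    (p : {poly R}) :
  is_minkowski_poly V p -> minkowski_poly V = p.
Proof.
move=> Vp; rewrite /minkowski_poly; apply: xget_unique => // q Vq.
apply/eqP; rewrite -subr_eq0; apply/negPn/negP => qp0.
pose s := [seq k%:R : R | k <- iota 0 (size (q - p))].
suff /(max_poly_roots qp0) : all (root (q - p)) s.
  have us : uniq s.
    by rewrite map_inj_uniq ?iota_uniq// => i j /eqP; rewrite eqr_nat => /eqP.
  by move=> /(_ us); rewrite size_map size_iota ltnn.
apply/allP => _ /mapP[k _ ->]; rewrite rootE hornerD hornerN subr_eq0.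
have k0 : 0 <= k%:R :> R by exact: ler0n.
by apply/eqP; apply: EFin_inj; rewrite -(Vp _ k0) -(Vq _ k0).
Qed.

Lemma weyl1_polyP (R : realType) (N : nat) (V : set 'rV[R]_N) :
  (2 *: 'X) * weyl1_poly V = minkowski_poly V - (minkowski_poly V \Po (- 'X)).
Proof.
rewrite mulrC; apply: divpK; rewrite dvdpZl ?pnatr_eq0//.
have := dvdp_XsubCl (minkowski_poly V - (minkowski_poly V \Po (- 'X))) 0.
rewrite polyC0 subr0 => ->.
by rewrite rootE hornerD hornerN horner_comp !hornerE oppr0 subrr.
Qed.

Lemma coef_weyl1_poly (R : realType) (N : nat) (V : set 'rV[R]_N) (i : nat) :
  (weyl1_poly V)`_i = if odd i then 0 else (minkowski_poly V)`_i.+1.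
Proof.
have two0 : (2 : R) != 0 by rewrite pnatr_eq0.
have /(congr1 (fun p : {poly R} => p`_i.+1)) := weyl1_polyP V.
rewrite -scalerAl coefZ coefXM/= coefB comp_polyE.
rewrite (eq_bigr (fun j : 'I__ =>
    ((-1) ^+ j * (minkowski_poly V)`_j) *: 'X^j)); last first.
  by move=> j _; rewrite -[- 'X]mulN1r -polyC1 -polyCN exprMn -polyC_exp
    mul_polyC scalerA mulrC.
rewrite -(poly_def _ (fun j => (-1) ^+ j * (minkowski_poly V)`_j)) coef_poly.
have -> : (if (i.+1 < size (minkowski_poly V))%N
    then (-1) ^+ i.+1 * (minkowski_poly V)`_i.+1 else 0) =
    (-1) ^+ i.+1 * (minkowski_poly V)`_i.+1.
  by case: ltnP => // ?; rewrite nth_default// mulr0.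
move=> H; apply: (mulfI two0); rewrite H -signr_odd/=.
by case: (odd i) => /=; rewrite ?expr0 ?expr1 ?mul1r ?subrr ?mulr0// mulN1r
  opprK mulr_natl mulr2n.
Qed.

Lemma volume_box (R : realType) (N : nat) (a b : 'rV[R]_N) :
  (forall i, a ord0 i <= b ord0 i) ->
  volume [set x : 'rV[R]_N | forall i, a ord0 i <= x ord0 i <= b ord0 i] =
  (\prod_(i < N) (b ord0 i - a ord0 i))%:E.
Proof.
elim: N a b => [|N IH] a b ab /=.
  by rewrite big_ord0 indicE mem_set// => -[].
pose a' : 'rV[R]_N := \row_i a ord0 (lift ord0 i).
pose b' : 'rV[R]_N := \row_i b ord0 (lift ord0 i).
have ab' i : a' ord0 i <= b' ord0 i by rewrite !mxE.
have E0 (x : R) (y : 'rV[R]_N) :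
    (row_mx (x%:M : 'rV[R]_1) y : 'rV[R]_N.+1) ord0 ord0 = x.
  transitivity ((x%:M : 'rV[R]_1) ord0 ord0); last by rewrite mxE mulr1n.
  by rewrite -[RHS](row_mxEl _ y); congr (fun_of_matrix _ _ _); exact: val_inj.
have E1 (x : R) (y : 'rV[R]_N) (j : 'I_N) :
    (row_mx (x%:M : 'rV[R]_1) y : 'rV[R]_N.+1) ord0 (lift ord0 j) = y ord0 j.
  rewrite -[RHS](row_mxEr (x%:M : 'rV[R]_1)).
  by congr (fun_of_matrix _ _ _); exact: val_inj.
have vol0 M : volume (set0 : set 'rV[R]_M) = 0%E.
  elim: M => [|M IHM] /=; first by rewrite indicE in_set0.
  by under eq_integral do rewrite IHM; rewrite integral0.
under eq_integral => x _.
  rewrite (_ : volume _ = ((\prod_(i < N) (b' ord0 i - a' ord0 i))%:E *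
      (\1_`[a ord0 ord0, b ord0 ord0] x)%:E)%E); last first.
    rewrite indicE mem_setE/= in_itv/=; case: (boolP (_ <= x <= _)) => xab.
      rewrite mule1 -IH//; congr volume; apply/seteqP; split => y /= H i.
        by have := H (lift ord0 i); rewrite E1 !mxE.
      case: (unliftP ord0 i) => [j|] ->; last by rewrite E0.
      by have := H j; rewrite E1 !mxE.
    rewrite mule0 (_ : [set _ | _] = set0) ?vol0// -subset0 => y /=.
    by move=> /(_ ord0); rewrite E0 (negbTE xab).
  over.
have P0 : (0%:E <= (\prod_(i < N) (b' ord0 i - a' ord0 i))%:E)%E.
  by rewrite lee_fin; apply: prodr_ge0 => i _; rewrite subr_ge0.
rewrite /= ge0_integralZl//; last first.
  by apply/measurable_EFinP; exact: measurable_indic.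
rewrite integral_indic// setIT.
rewrite [X in (_ * X)%E](_ : _ = (b ord0 ord0 - a ord0 ord0)%:E); last first.
  transitivity (lebesgue_measure
    ([set` `[a ord0 ord0, b ord0 ord0]] : set R)) => //.
  rewrite lebesgue_measure_itv/= lte_fin.
  by case: ltgtP (ab ord0) => [_ _|//|-> _]; rewrite ?subrr ?EFinB.
rewrite big_ord_recl EFinM muleC; congr (_ * (_)%:E)%E.
by apply: eq_bigr => i _; rewrite !mxE.
Qed.

(* Main.v *)
Require Import Defs.
From mathcomp Require Import all_boot all_order all_algebra.
From mathcomp Require Import complex.
From mathcomp Require Import all_classical all_reals all_analysis.
From mathcomp Require Import ring lra.
Import numFieldNormedType.Exports HBNNSimple.
Import Order.TTheory GRing.Theory Num.Theory.
Import ComplexField.Normc.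
Local Open Scope classical_set_scope.
Local Open Scope ring_scope.

Set Implicit Arguments.
Unset Strict Implicit.
Unset Printing Implicit Defensive.

(** Let [M] be the Minkowski polynomial and [D(z) = M(z) - M(-z) = 2 z W(z)]
    with [W] the Weyl polynomial. The argument is of Hermite-Biehler type.

    Write [M] as a constant times the product of the [z - a], where
    [Re a < 0].

    - If [Re z > 0], then [z] is farther from each [a] than its mirror image
      [-conj z] in the imaginary axis, so that [|M(-conj z)| < |M(z)|]
      ([normc_horner_reflect]). Since [M] is real, [|M(-conj z)| = |M(-z)|],
      hence [D(z) <> 0]. As [D] is odd, its roots, and so those of [W], are
      purely imaginary ([Re_root_odd_diff]).
    - If [Re z = 0], then [M'(z) / M(z)], the sum of the [1 / (z - a)], has
      positive real part, and likewise at [-z]. When [D(z) = 0] the values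
      [M(z) = M(-z)] agree, so [D'(z) / M(z) = M'(z) / M(z) + M'(-z) / M(-z)]
      is nonzero ([deriv_odd_diff_neq0]). At a root of [W] one has
      [D'(z) = 2 z W'(z)], hence [W'(z) <> 0] and the root is simple.

    Both steps need [M] to have positive degree: the strict inequalities fail
    for an empty product, and a nonzero constant [M] would be dissipative with
    [W = 0]. The degree is positive because a parallel body at distance [t]
    contains a cube of side proportional to [t], so its volume is unbounded in
    [t] ([size_is_minkowski_poly]). *)

(** * Growth of the volume of parallel bodies *)

(** The integral of a nonnegative function is a supremum over the simple
    functions below it, so it is monotone even without measurability. This
    avoids proving that the section volumes of a parallel body are
    measurable. *)
Lemma ge0_le_integral_nonmeasurable d (T : measurableType d) (R : realType)
    (mu : {measure set T -> \bar R}) (f g : T -> \bar R) :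
  (forall x, 0 <= f x)%E -> (forall x, f x <= g x)%E ->
  (\int[mu]_x f x <= \int[mu]_x g x)%E.
Proof.
move=> f0 fg; have g0 x : (0 <= g x)%E by exact: le_trans (f0 x) (fg x).
rewrite !ge0_integralTE//; apply: ereal_sup_le => _ [h hf <-].
by exists h => // x; exact: le_trans (hf x) (fg x).
Qed.

Lemma volume_ge0 (R : realType) (N : nat) (A : set 'rV[R]_N) :
  (0 <= volume A)%E.
Proof.
elim: N A => [|N IH] A /=; first by rewrite lee_fin indicE; case: (_ \in _).
by apply: integral_ge0 => x _; exact: IH.
Qed.

Lemma le_volume (R : realType) (N : nat) (A B : set 'rV[R]_N) :
  A `<=` B -> (volume A <= volume B)%E.
Proof.
elim: N A B => [|N IH] A B AB /=.
  rewrite lee_fin !indicE ler_nat; case: (boolP (_ \in A)) => //= /set_mem/AB.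
  by move=> /mem_set->.
apply: ge0_le_integral_nonmeasurable => x; first exact: volume_ge0.
by apply: IH => y; exact: AB.
Qed.

(** The sharp radius would be [sqrt N * a]; the larger [N * a] avoids the
    square root. *)
Lemma box_sub_parallel_body (R : realType) (N : nat) (V : set 'rV[R]_N)
    (v : 'rV[R]_N) (a : R) : (0 < N)%N -> 0 < a -> V v ->
  [set x : 'rV[R]_N | forall i, v ord0 i - a <= x ord0 i <= v ord0 i + a]
    `<=` parallel_body V (N%:R * a).
Proof.
move=> N0 a0 Vv x /= Hx; exists v => //.
have N0' : 0 < N%:R :> R by rewrite ltr0n.
have Na0 : 0 < N%:R * a by exact: mulr_gt0.
exists ((N%:R * a)^-1 *: (x - v)); last first.
  by rewrite scalerA divff ?gt_eqF// scale1r addrC subrK.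
rewrite /euclidean_unit_ball /euclidean_norm /= -[leRHS]sqrtr1 ler_sqrt//.
have le1 (i : 'I_N) :
    ((N%:R * a)^-1 *: (x - v)) ord0 i ^+ 2 <= N%:R^-1.
  rewrite !mxE exprMn exprVn mulrC ler_pdivrMr ?exprn_gt0//.
  have N1 : 1 <= N%:R :> R by rewrite ler1n.
  have -> : N%:R^-1 * (N%:R * a) ^+ 2 = N%:R * a ^+ 2.
    by field; rewrite gt_eqF.
  have : (x ord0 i - v ord0 i) ^+ 2 <= a ^+ 2.
    by rewrite -real_normK ?num_real// lerXn2r ?nnegrE ?(ltW a0)//
      ler_distl; have := Hx i.
  by move=> /le_trans; apply; rewrite ler_peMl// sqr_ge0.
apply: (le_trans (ler_sum _ (fun i _ => le1 i))).
by rewrite sumr_const card_ord -(mulr_natr N%:R^-1) mulVf ?gt_eqF.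
Qed.

(** If the polynomial were a constant [c], then a cube of side [1 + |c|], which
    fits into some parallel body, would have volume at most [c]. *)
Lemma size_is_minkowski_poly (R : realType) (N : nat) (V : set 'rV[R]_N)
    (p : {poly R}) :
  (0 < N)%N -> V !=set0 -> is_minkowski_poly V p -> (1 < size p)%N.
Proof.
move=> N0 [v Vv] Vp; rewrite ltnNge; apply/negP => /size1_polyC pc.
pose c := p`_0.
pose a : R := (1 + `|c|) / 2.
have c1 : 1 <= 1 + `|c| by rewrite lerDl.
have a0 : 0 < a by rewrite divr_gt0// (lt_le_trans _ c1).
have := le_volume (box_sub_parallel_body N0 a0 Vv).
rewrite Vp ?mulr_ge0 ?(ltW a0)// pc hornerC.
have := @volume_box R N (v - const_mx a) (v + const_mx a).
under eq_set => x do under eq_forall => i do rewrite !mxE.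
move=> ->; last by move=> i; rewrite !mxE; lra.
have side (y : R) : y + a - (y - a) = 1 + `|c| by rewrite /a; field.
under eq_bigr => i _ do rewrite !mxE side.
rewrite lee_fin prodr_const card_ord leNgt => /negP; apply.
rewrite (lt_le_trans (y := 1 + `|c|))//; last by rewrite ler_eXnr.
by rewrite (le_lt_trans (ler_norm _))// ltrDr.
Qed.

(** * Polynomials with all roots in the open left half-plane *)

Section HalfPlane.
Variable R : realType.
Implicit Types (z a w : R[i]) (s : seq R[i]) (P : {poly R[i]}).

(** The difference of the squared distances is [-4 Re z Re a > 0]. *)
Lemma normc_sub_reflect z a : 0 < complex.Re z -> complex.Re a < 0 ->
  normc (- (conjc z) - a) < normc (z - a).
Proof.
case: z a => x y [b c] /= x0 b0.
rewrite ltr_sqrt; first nra.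
have : 0 < (x - b) ^+ 2 by rewrite exprn_gt0// subr_gt0 (lt_trans b0).
by have := sqr_ge0 (y - c); lra.
Qed.

Lemma dissipative_prod P : (1 < size P)%N -> dissipative P ->
  exists s, [/\ P = lead_coef P *: \prod_(a <- s) ('X - a%:P),
    lead_coef P != 0, s != [::] & {in s, forall a, complex.Re a < 0}].
Proof.
move=> P1 dP; have [s Ps] := closed_field_poly_normal P.
have P0 : lead_coef P != 0 by rewrite lead_coef_eq0 -size_poly_gt0 ltnW.
exists s; split => //.
- apply/eqP => s0; move: P1.
  by rewrite Ps s0 big_nil size_scale// size_poly1.
- by move=> a sa; apply: dP; rewrite Ps rootZ// root_prod_XsubC.
Qed.

(** The factorwise inequality [normc_sub_reflect] multiplied over all roots.
    Reflecting by [-conj z] rather than by [-z] lets each root be compared with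
    itself rather than with its conjugate, which would have to be matched with
    another root. *)
Lemma normc_horner_reflect P z : (1 < size P)%N -> dissipative P ->
  0 < complex.Re z -> normc P.[- (conjc z)] < normc P.[z].
Proof.
move=> P1 dP z0; have [s [Ps P0 s0 sN]] := dissipative_prod P1 dP.
have nP w : normc P.[w] = normc (lead_coef P) * \prod_(a <- s) normc (w - a).
  rewrite {1}Ps hornerZ normcM horner_prod.
  rewrite (big_morph _ (@normcM R) (@normc1 R)).
  by congr (_ * _); apply: eq_bigr => a _; rewrite hornerXsubC.
have c0 : 0 < normc (lead_coef P).
  rewrite lt0r; apply/andP; split.
    by apply: contra P0 => /eqP/eq0_normc->.
  by case: (lead_coef P) => x y; exact: sqrtr_ge0.
rewrite !nP ltr_pM2l// big_seq [ltRHS]big_seq; apply: ltr_prod.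
  by case: s s0 {Ps sN nP} => // a s _; rewrite /= mem_head.
move=> a sa; rewrite normc_sub_reflect ?sN// andbT.
by case: (- _ - a) => x y; exact: sqrtr_ge0.
Qed.

Lemma log_deriv_prod_XsubC s z : z \notin s ->
  (\prod_(a <- s) ('X - a%:P))^`().[z] / (\prod_(a <- s) ('X - a%:P)).[z] =
  \sum_(a <- s) (z - a)^-1.
Proof.
elim: s => [|a s IH]; first by rewrite !big_nil derivC horner0 mul0r.
rewrite inE negb_or => /andP[za zs]; rewrite !big_cons -IH//.
rewrite derivM derivXsubC mul1r !(hornerE, hornerXsubC).
field; rewrite subr_eq0 za andbT.
by have := root_prod_XsubC s z; rewrite rootE => ->.
Qed.

Lemma Re_inv_gt0 w : 0 < complex.Re w -> 0 < complex.Re w^-1.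
Proof.
case: w => x y /= x0; rewrite divr_gt0//.
by rewrite ltr_pwDl ?sqr_ge0 ?exprn_gt0.
Qed.

(** Each term [1 / (z - a)] of the logarithmic derivative has positive real
    part, since [Re (z - a) > 0]. *)
Lemma Re_log_deriv_gt0 P z : (1 < size P)%N -> dissipative P ->
  0 <= complex.Re z -> 0 < complex.Re (P^`().[z] / P.[z]).
Proof.
move=> P1 dP z0; have [s [Ps P0 s0 sN]] := dissipative_prod P1 dP.
have zs : z \notin s by apply/negP => /sN; rewrite ltNge z0.
rewrite Ps derivZ !hornerZ -mulf_div divff// mul1r log_deriv_prod_XsubC//.
have ReD : {morph @complex.Re R : x y / x + y} by case=> ? ? [].
rewrite (big_morph _ ReD (erefl _)).
case: s s0 sN {Ps zs} => // a s _ sN.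
have H b : b \in a :: s -> 0 < complex.Re (z - b)^-1.
  move=> /sN b0; apply: Re_inv_gt0.
  by case: z z0 b b0 => ? ? /= ? [? ?] /= ?; lra.
rewrite big_cons ltr_pwDl ?H ?mem_head// big_seq sumr_ge0// => b bs.
by rewrite ltW// H// inE bs orbT.
Qed.

Lemma horner_complex_polyJ (p : {poly R}) z :
  (complex_poly p).[conjc z] = conjc (complex_poly p).[z].
Proof.
rewrite -horner_map /complex_poly -map_poly_comp; congr (_.[_]).
by apply: eq_map_poly => x /=; rewrite oppr0.
Qed.

Definition odd_diff P := P - (P \Po (- 'X)).

(** A root of [odd_diff P] has [|P(z)| = |P(-z)|]; for real [P] this is
    [|P(z)| = |P(-conj z)|], which [normc_horner_reflect] excludes at [z] when
    [Re z > 0] and at [-z] when [Re z < 0]. *)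
Lemma Re_root_odd_diff (p : {poly R}) z :
  let P := complex_poly p in
  (1 < size P)%N -> dissipative P -> root (odd_diff P) z ->
  complex.Re z = 0.
Proof.
move=> P P1 dP.
have D w : root (odd_diff P) w = (P.[w] == P.[- w]).
  by rewrite rootE hornerD hornerN horner_comp !hornerE subr_eq0.
have noroot w : 0 < complex.Re w -> P.[w] != P.[- w].
  move=> w0; apply/eqP => Pw.
  have := normc_horner_reflect P1 dP w0.
  rewrite Pw -rmorphN horner_complex_polyJ.
  by case: _.[_] => x y /=; rewrite sqrrN ltxx.
rewrite D => Pz; case: (ltgtP (complex.Re z) 0) => // z0.
- have /noroot : 0 < complex.Re (- z) by case: z z0 {Pz} => x y /=; lra.
  by rewrite opprK eq_sym Pz.
- by have /noroot := z0; rewrite Pz.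
Qed.

(** Where [P(z) = P(-z)], the quotient [D'(z) / P(z)] is the sum of the
    logarithmic derivatives of [P] at [z] and at [-z], both on the imaginary
    axis, hence has positive real part. *)
Lemma deriv_odd_diff_neq0 P z : (1 < size P)%N -> dissipative P ->
  complex.Re z = 0 -> root (odd_diff P) z -> (odd_diff P)^`().[z] != 0.
Proof.
move=> P1 dP z0; rewrite rootE hornerD hornerN horner_comp !hornerE subr_eq0.
move=> /eqP Pz; rewrite /odd_diff derivB deriv_comp derivN derivX.
rewrite !(hornerE, horner_comp); apply/eqP => D0.
have Nz0 : complex.Re (- z) = 0 by case: z z0 {Pz D0} => x y /= ->; rewrite oppr0.
have := addr_gt0 (@Re_log_deriv_gt0 P z P1 dP _)
  (@Re_log_deriv_gt0 P (- z) P1 dP _).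
have -> : complex.Re (P^`().[z] / P.[z]) + complex.Re (P^`().[- z] / P.[- z]) =
    complex.Re ((P^`().[z] + P^`().[- z]) / P.[z]).
  by rewrite -Pz mulrDl; case: (_ / _) (_ / _) => ? ? [].
have -> : P^`().[z] + P^`().[- z] = 0 by move: D0; rewrite mulrN1 opprK.
by rewrite mul0r z0 Nz0 ltxx => /(_ (lexx _) (lexx _)).
Qed.

End HalfPlane.

(** * Simple roots of the Weyl polynomial *)

Lemma mup_simple_root (F : fieldType) (q : {poly F}) (z : F) :
  root q z -> q^`().[z] != 0 -> mup z q = 1%N.
Proof.
move=> qz q'z; have q0 : q != 0.
  by apply: contraNneq q'z => ->; rewrite derivC horner0.
apply/eqP; rewrite eqn_leq mup_leq// -XsubC_dvd// dvdp_XsubCl qz andbT.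
apply: contraNN q'z => /dvdpP[r ->].
by rewrite expr2 !derivM derivXsubC !hornerE /= subrr
  !(mulr0, mul0r, addr0, add0r) ?subrr ?mulr0.
Qed.

Unset Implicit Arguments.

Theorem theorem2p1 (R : realType) (n : nat) (V : set 'rV[R]_n.+1) :
  (1 <= n)%N ->
  V !=set0 -> compact V -> convex_set V ->
  dissipative (complex_poly (minkowski_poly V)) ->
  conservative (complex_poly (weyl1_poly V)).
Proof.
move=> _ V0 _ _ dP z Wz.
set P := complex_poly (minkowski_poly V) in dP.
set W := complex_poly (weyl1_poly V) in Wz *.
(* The default value 0 is not dissipative, as 0 is one of its roots; so the
   hypothesis forces a Minkowski polynomial to exist. *)
have pV : is_minkowski_poly V (minkowski_poly V).
  have [[p Vp]|nop] := pselect (exists p, is_minkowski_poly V p).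
    by rewrite (minkowski_polyE Vp).
  have M0 : minkowski_poly V = 0.
    by apply: xgetPN => p Vp; apply: nop; exists p.
  have : root P 0 by rewrite /P M0 /complex_poly rmorph0 root0.
  by move=> /dP; rewrite ltxx.
have P1 : (1 < size P)%N.
  by rewrite size_map_poly (size_is_minkowski_poly _ V0 pV).
have DW : odd_diff P = (2 *: 'X) * W.
  have := congr1 (map_poly (real_complex R)) (weyl1_polyP V).
  rewrite rmorphM rmorphB /= map_comp_poly map_polyZ rmorphN /= map_polyX.
  by rewrite rmorph_nat => ->.
have Dz : root (odd_diff P) z by rewrite DW rootM Wz orbT.
have z0 := Re_root_odd_diff P1 dP Dz.
split => //; apply: mup_simple_root => //.
have := deriv_odd_diff_neq0 P1 dP z0 Dz.
apply: contraNneq => W'z.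
by rewrite DW derivM hornerD !hornerM W'z (rootP Wz) !mulr0 addr0.
Qed.
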